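(* There is an absolute constant $C$ such that for every odd integer $p\ge 3$, every $k\in\mathbb{Z}_p$ and every $\epsilon\in(0,1)$, the Pollard Rho walk with parameter $k$ on $\mathbb{Z}_p$ has mixing time in separation distance satisfying $$\tau_s(\epsilon)\le C\,(\log p)^2\,\log(p/\epsilon).$$
   Context: The Pollard Rho walk with parameter $k$ on $\mathbb{Z}_p$ ($p$ odd) is the Markov chain which at each step moves from $i$ to $i+1$, to $i+k$, or to $2i$ (all modulo $p$), each with probability $1/3$ (probabilities of coinciding targets are added). Its stationary distribution $\pi$ is uniform on $\mathbb{Z}_p$. For a Markov chain with transition matrix $P$ on a finite state space $V$ and stationary distribution $\pi$, the mixing time in separation distance is $$\tau_s(\epsilon)=\min\Bigl\{n:\ \forall x,y\in V,\ 1-\frac{P^n(x,y)}{\pi(y)}\le\epsilon\Bigr\}.$$ Logarithms are natural. *)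

(* Defs.v *)
From HB Require Import structures.
From mathcomp Require Import all_boot all_order all_algebra.
From mathcomp Require Import reals exp.

Set Implicit Arguments.
Unset Strict Implicit.
Unset Printing Implicit Defensive.

Import Order.TTheory GRing.Theory Num.Theory.
Local Open Scope ring_scope.

Section MarkovChain.
Variables (R : realType) (m : nat).
Implicit Types (P : 'M[R]_m) (pi : 'rV[R]_m).

Definition stochastic P : Prop :=
  (forall x y, 0 <= P x y) /\ (forall x, \sum_y P x y = 1).

Definition stationary_distribution P pi : Prop :=
  [/\ forall x, 0 <= pi 0 x, \sum_x pi 0 x = 1 & pi *m P = pi].

Definition sep_mixed P pi (eps : R) (n : nat) : Prop :=
  forall x y, 1 - (P ^+ n) x y / pi 0 y <= eps.

(* [t] is the least [n] such that [sep_mixed P pi eps n]. This is a relation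
   because a general chain may have no such [n]. *)
Definition is_sep_mixing_time P pi (eps : R) (t : nat) : Prop :=
  sep_mixed P pi eps t /\ (forall n, sep_mixed P pi eps n -> (t <= n)%N).

End MarkovChain.

(* ['Z_p] is the ordinal type with [(Zp_trunc p).+2] elements, which is [p]
   only for [1 < p]. *)
Definition pollard_rho (R : realType) (p : nat) (k : 'Z_p) :
    'M[R]_((Zp_trunc p).+2) :=
  \matrix_(i, j)
    (((j == i + 1)%:R + (j == i + k)%:R + (j == 2%:R * i)%:R) / 3%:R).

Definition uniform_Zp (R : realType) (p : nat) : 'rV[R]_((Zp_trunc p).+2) :=
  const_mx p%:R^-1.

Lemma sum_delta (R : realType) (p : nat) (f : 'Z_p -> R) (a : 'Z_p) :
  \sum_j (j == a)%:R * f j = f a.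
Proof.
rewrite (bigD1 a) //= eqxx mul1r big1 ?addr0 // => j /negPf ->.
by rewrite mul0r.
Qed.

Lemma pollard_rho_stochastic (R : realType) (p : nat) (k : 'Z_p) :
  stochastic (pollard_rho R k).
Proof.
split=> [x y|x]; first by rewrite mxE divr_ge0 ?addr_ge0 ?ler0n.
under eq_bigr do rewrite mxE.
have S a : \sum_(j : 'Z_p) ((j == a)%:R : R) = 1.
  by rewrite -[RHS](sum_delta (fun=> 1) a); apply: eq_bigr => j _; rewrite mulr1.
rewrite -mulr_suml !big_split /= !S -addrA divff //.
by rewrite (pnatr_eq0 R 3).
Qed.

Lemma uniform_Zp_stationary (R : realType) (p : nat) (k : 'Z_p) :
  odd p -> (3 <= p)%N ->
  stationary_distribution (pollard_rho R k) (uniform_Zp R p).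
Proof.
move=> p_odd p_ge3; have p_gt1 : (1 < p)%N by apply: leq_trans p_ge3.
split=> [x||]; first by rewrite mxE invr_ge0 ler0n.
  under eq_bigr do rewrite mxE.
  rewrite sumr_const card_ord Zp_cast // -[LHS]mulr_natl divff //.
  by rewrite pnatr_eq0 -lt0n ltnW.
apply/rowP=> y; rewrite !mxE; under eq_bigr do rewrite !mxE.
have S (f : 'Z_p -> 'Z_p) : injective f -> \sum_x ((y == f x)%:R : R) = 1.
  move=> f_inj; have [g fK gK] := injF_bij f_inj.
  rewrite -[RHS](sum_delta (fun=> 1) (g y)); apply: eq_bigr => x _.
  by rewrite mulr1 -(can_eq fK x) gK eq_sym.
have inj2 : injective (fun x : 'Z_p => 2%:R * x).
  by apply: mulrI; rewrite unitZpE // coprimen2.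
rewrite -mulr_sumr -mulr_suml !big_split /=.
rewrite (S (fun x => x + 1)); last exact: addIr.
rewrite (S (fun x => x + k)); last exact: addIr.
rewrite (S _ inj2) -addrA divff ?mulr1 //.
by rewrite (pnatr_eq0 R 3).
Qed.

(* Main.v *)
Require Import Defs.
From mathcomp Require Import all_boot all_order all_algebra.
From mathcomp Require Import reals exp.
From mathcomp Require Import archimedean sequences ring lra.

Set Implicit Arguments.
Unset Strict Implicit.
Unset Printing Implicit Defensive.

Import Order.TTheory GRing.Theory Num.Theory.
Local Open Scope ring_scope.

(* Two steps of the walk can lead from [x] to each of [2x + 1], [2x + 2] and
   [4x]. Hence if averaging twice barely decreases the l2 norm of a function
   [f], then [f] is l2-close to its translate by [1] and, comparing [2x + 1]
   with [2 (2x)], to its composite with doubling; [k] plays no role. Every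
   translation is a word of length O(log p) in these two maps and their
   inverses, so [f] is close to all its translates, which is impossible for [f]
   of mean zero. Quantitatively, two steps contract the squared l2 norm of mean
   zero functions by a factor [1 - c / (log p) ^ 2]; applied to the columns of
   [P ^ n] minus [1 / p], this bounds all the entries [P ^ n x y - 1 / p]. *)

(* The triangle inequality in l2, [|u - v| <= n s] and [|v - w| <= s] giving
   [|u - w| <= (n + 1) s], with [S = s ^ 2] to avoid square roots. *)
Lemma sqr_triangle (R : realDomainType) (T : finType) (u v w : T -> R) (n : nat)
    (S : R) :
  \sum_x (u x - v x) ^+ 2 <= n%:R ^+ 2 * S -> \sum_x (v x - w x) ^+ 2 <= S ->
  \sum_x (u x - w x) ^+ 2 <= n.+1%:R ^+ 2 * S.
Proof.
case: n => [|n] uv vw.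
  rewrite expr0n mul0r in uv; have uv0 x : u x = v x.
    apply/eqP; rewrite -subr_eq0 -sqrf_eq0 eq_le sqr_ge0 andbT.
    apply: le_trans uv; rewrite (bigD1 x) //= lerDl.
    by apply: sumr_ge0 => y _; apply: sqr_ge0.
  by rewrite expr1n mul1r; under eq_bigr do rewrite uv0.
set N : R := n.+1%:R in uv *; have N0 : 0 < N by rewrite ltr0n.
have -> : n.+2%:R = N + 1 :> R by rewrite -natr1.
(* Weighted Young inequality [N (a + b)^2 <= (N + 1) a^2 + N (N + 1) b^2], tight at [a = N b];
   multiplying by [N] is why zero was treated apart. *)
rewrite -(ler_pM2l N0) mulr_sumr.
apply: (@le_trans _ _ (\sum_x ((N + 1) * (u x - v x) ^+ 2 +
                               N * (N + 1) * (v x - w x) ^+ 2))).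
  apply: ler_sum => x _; rewrite -subr_ge0.
  suff -> : (N + 1) * (u x - v x) ^+ 2 + N * (N + 1) * (v x - w x) ^+ 2 -
      N * (u x - w x) ^+ 2 = ((u x - v x) - N * (v x - w x)) ^+ 2.
    exact: sqr_ge0.
  by ring.
rewrite big_split -!mulr_sumr /=.
have N1 : 0 < N + 1 by rewrite addr_gt0.
have -> : N * ((N + 1) ^+ 2 * S) = (N + 1) * (N ^+ 2 * S) + N * (N + 1) * S by ring.
by rewrite lerD ?ler_pM2l ?mulr_gt0.
Qed.

(** * The averaging operator and displacement along affine maps *)

Section OddModulus.
Variables (R : realType) (p : nat).
Hypotheses (p_odd : odd p) (p_gt1 : (1 < p)%N).
Implicit Types (f : 'Z_p -> R) (a k : 'Z_p).

Lemma double_inj : injective (fun x : 'Z_p => 2%:R * x).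
Proof. by apply: mulrI; rewrite unitZpE // coprimen2. Qed.

Lemma sum_shift f a : \sum_x f (x + a) = \sum_x f x.
Proof. by rewrite [RHS](reindex_inj (addIr a)). Qed.

Lemma sum_double f : \sum_x f (2%:R * x) = \sum_x f x.
Proof. by rewrite [RHS](reindex_inj double_inj). Qed.

Lemma sum_cst (c : R) : \sum_(x : 'Z_p) c = p%:R * c.
Proof. by rewrite sumr_const card_ord Zp_cast // mulr_natl. Qed.

(** The transition matrix acting on functions, seen as column vectors. *)
Definition step_avg k f : 'Z_p -> R :=
  fun x => (f (x + 1) + f (x + k) + f (2%:R * x)) / 3%:R.

Lemma sum_step_avg k f : \sum_x step_avg k f x = \sum_x f x.
Proof.
rewrite -mulr_suml !big_split /= !sum_shift sum_double.
by field.
Qed.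

(** Two steps average [f] over nine endpoints, each a bijective function of [x]. By the variance
    identity the squared norm loses [1 / 81] of the squared differences over all pairs of endpoints;
    two of these pairs are kept. *)
Lemma sqr_sum_step_avg2 k f :
  \sum_x (step_avg k (step_avg k f) x) ^+ 2 <= \sum_x f x ^+ 2 -
    (\sum_x (f x - f (x + 1)) ^+ 2 + \sum_x (f (x + 1) - f (2%:R * x)) ^+ 2) / 81%:R.
Proof.
(* Substituting [2x + 1] for [x] here, and [2x] in [D3], makes both sums compare endpoints of two
   steps from [x]. *)
have D1 : \sum_x (f x - f (x + 1)) ^+ 2 =
    \sum_x (f (2%:R * x + 1) - f (2%:R * (x + 1))) ^+ 2.
  rewrite -(sum_shift (fun x => (f x - f (x + 1)) ^+ 2) 1) -sum_double.
  by apply: eq_bigr => x _; rewrite mulrDr mulr1 -addrA.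
have D3 : \sum_x (f (x + 1) - f (2%:R * x)) ^+ 2 =
    \sum_x (f (2%:R * x + 1) - f (2%:R * (2%:R * x))) ^+ 2.
  by rewrite -sum_double.
have E : \sum_x f x ^+ 2 = \sum_x (f (x + 1 + 1) ^+ 2 + f (x + 1 + k) ^+ 2 +
    f (2%:R * (x + 1)) ^+ 2 + f (x + k + 1) ^+ 2 + f (x + k + k) ^+ 2 +
    f (2%:R * (x + k)) ^+ 2 + f (2%:R * x + 1) ^+ 2 + f (2%:R * x + k) ^+ 2 +
    f (2%:R * (2%:R * x)) ^+ 2) / 9%:R.
  pose F x := f x ^+ 2.
  rewrite -mulr_suml !big_split /=.
  rewrite !(sum_shift (fun x => F (x + _)), sum_shift (fun x => F (2%:R * x)),
    sum_double (fun x => F (x + _)), sum_double (fun x => F (2%:R * x)),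
    sum_shift F, sum_double F) /F.
  by field.
rewrite D1 D3 E -big_split /= mulr_suml -sumrB.
apply: ler_sum => x _; rewrite /step_avg.
move: (f (x + 1 + 1)) (f (x + 1 + k)) (f (2%:R * (x + 1))) (f (x + k + 1))
  (f (x + k + k)) (f (2%:R * (x + k))) (f (2%:R * x + 1)) (f (2%:R * x + k))
  (f (2%:R * (2%:R * x))) => a b c d e g h i j.
rewrite -subr_ge0.
set X := (X in 0 <= X).
(* Of the 36 squared differences in
   [9 * (sum of squares) - (square of the sum)], two cancel. *)
have -> : X = ((a-b)^+2 + (a-c)^+2 + (a-d)^+2 + (a-e)^+2 + (a-g)^+2 + (a-h)^+2
  + (a-i)^+2 + (a-j)^+2 + (b-c)^+2 + (b-d)^+2 + (b-e)^+2 + (b-g)^+2 + (b-h)^+2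
  + (b-i)^+2 + (b-j)^+2 + (c-d)^+2 + (c-e)^+2 + (c-g)^+2
  + (c-i)^+2 + (c-j)^+2 + (d-e)^+2 + (d-g)^+2 + (d-h)^+2 + (d-i)^+2 + (d-j)^+2
  + (e-g)^+2 + (e-h)^+2 + (e-i)^+2 + (e-j)^+2 + (g-h)^+2 + (g-i)^+2 + (g-j)^+2
  + (h-i)^+2 + (i-j)^+2) / 81%:R.
  by rewrite /X; field.
by rewrite divr_ge0 // !addr_ge0 ?sqr_ge0.
Qed.

(* Horner's scheme: [x |-> 2 ^ m * x + j] is a composite of at most [2 * m]
   maps [x |-> x + 1] and [x |-> 2 * x]. *)
Lemma sqr_affine_le f (S : R) (m j : nat) :
  \sum_x (f x - f (x + 1)) ^+ 2 <= S -> \sum_x (f x - f (2%:R * x)) ^+ 2 <= S ->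
  (j < 2 ^ m)%N ->
  \sum_x (f x - f (2%:R ^+ m * x + j%:R)) ^+ 2 <= (2 * m)%:R ^+ 2 * S.
Proof.
move=> S1 S2; elim: m j => [|m IH] j.
  rewrite expn0 ltnS leqn0 => /eqP ->; rewrite muln0 expr0n mul0r big1 // => x _.
  by rewrite expr0 mul1r addr0 subrr expr0n.
move=> j_lt; have {}IH := IH j./2.
(* This affine map is a bijection, so the bounds by [S] also hold along its values. *)
have affE (F : 'Z_p -> R) : \sum_x F (2%:R ^+ m * x + j./2%:R) = \sum_x F x.
  elim: (m) F => [|n IHn] F.
    by rewrite -[RHS](sum_shift _ j./2%:R); apply: eq_bigr => x _; rewrite mul1r.
  rewrite -[RHS]IHn -[RHS]sum_double.
  by apply: eq_bigr => x _; rewrite mulrA exprSr.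
have S0 : 0 <= S by apply: le_trans S1; apply: sumr_ge0 => x _; apply: sqr_ge0.
have -> : (2 * m.+1 = (2 * m).+2)%N by rewrite mulnS.
set A := fun x : 'Z_p => 2%:R ^+ m * x + j./2%:R.
(* Three legs: to [A x] by induction, then doubling, then adding the low bit of [j]. *)
apply: (@sqr_triangle _ _ _ (fun x => f (2%:R * A x))).
  apply: (@sqr_triangle _ _ _ (fun x => f (A x))).
    by apply: IH; rewrite ltn_half_double -mul2n -expnS.
  by rewrite (affE (fun x => (f x - f (2%:R * x)) ^+ 2)).
have Aj x : 2%:R ^+ m.+1 * x + j%:R = 2%:R * A x + (odd j)%:R.
  by rewrite /A -{1}(odd_double_half j) natrD -mul2n natrM exprS; ring.
under eq_bigr do rewrite Aj.
rewrite (affE (fun x => (f (2%:R * x) - f (2%:R * x + (odd j)%:R)) ^+ 2)).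
rewrite (sum_double (fun x => (f x - f (x + (odd j)%:R)) ^+ 2)).
case: (odd j) => //; rewrite big1 // => x _.
by rewrite addr0 subrr expr0n.
Qed.

(** Both [2^m x] and [2^m x + a] are reached from [x] by at most [2 m] moves, and [2^m x] runs over
    all residues. The constant is [2 * 4 + 2 * 4], from [(u - v)^2 <= 2 u^2 + 2 v^2]. *)
Lemma sqr_shift_le f (S : R) (m : nat) a :
  \sum_x (f x - f (x + 1)) ^+ 2 <= S -> \sum_x (f x - f (2%:R * x)) ^+ 2 <= S ->
  (p <= 2 ^ m)%N ->
  \sum_x (f x - f (x + a)) ^+ 2 <= 16%:R * m%:R ^+ 2 * S.
Proof.
move=> S1 S2 pm.
have powE (F : 'Z_p -> R) : \sum_x F (2%:R ^+ m * x) = \sum_x F x.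
  elim: (m) F => [|n IHn] F; first by apply: eq_bigr => x _; rewrite mul1r.
  by rewrite -[RHS]sum_double -[RHS]IHn; apply: eq_bigr => x _; rewrite exprS mulrA.
have m0 : (0 < 2 ^ m)%N by rewrite expn_gt0.
have am : (a < 2 ^ m)%N by apply: leq_trans pm; rewrite -[ltnRHS](Zp_cast p_gt1).
have H0 := sqr_affine_le S1 S2 m0; have Ha := sqr_affine_le S1 S2 am.
rewrite -powE.
apply: (@le_trans _ _ (\sum_x (2%:R * (f x - f (2%:R ^+ m * x + 0%:R)) ^+ 2 +
    2%:R * (f x - f (2%:R ^+ m * x + (a : nat)%:R)) ^+ 2))).
  apply: ler_sum => x _; rewrite addr0 natr_Zp.
  rewrite -subr_ge0; set X := (X in 0 <= X).
  suff -> : X = (f x - f (2%:R ^+ m * x) + (f x - f (2%:R ^+ m * x + a))) ^+ 2.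
    exact: sqr_ge0.
  by rewrite /X; ring.
rewrite big_split -!mulr_sumr /=; move: H0 Ha; rewrite natrM; lra.
Qed.

(** * Poincaré inequality and contraction in l2 *)

(** The cross terms of the expanded squares vanish because [f] has mean zero. *)
Lemma sum_sqr_shift f : \sum_x f x = 0 ->
  \sum_a \sum_x (f x - f (x + a)) ^+ 2 = 2%:R * p%:R * \sum_x f x ^+ 2.
Proof.
move=> f0; rewrite exchange_big /=.
have E x : \sum_a (f x - f (x + a)) ^+ 2 = p%:R * f x ^+ 2 + \sum_a f a ^+ 2.
  transitivity (\sum_a (f x ^+ 2 - 2%:R * f x * f (a + x) + f (a + x) ^+ 2)).
    by apply: eq_bigr => a _; rewrite (addrC x); ring.
  rewrite !big_split /= sum_cst sumrN -mulr_sumr.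
  rewrite (sum_shift f) (sum_shift (fun x => f x ^+ 2)) f0 mulr0 subr0.
  by [].
rewrite (eq_bigr _ (fun x _ => E x)) big_split /= -mulr_sumr sum_cst.
by ring.
Qed.

(** Follows by averaging the bound on translates over all [a]. *)
Lemma poincare f (S : R) (m : nat) : \sum_x f x = 0 ->
  \sum_x (f x - f (x + 1)) ^+ 2 <= S -> \sum_x (f x - f (2%:R * x)) ^+ 2 <= S ->
  (p <= 2 ^ m)%N -> \sum_x f x ^+ 2 <= 8%:R * m%:R ^+ 2 * S.
Proof.
move=> f0 S1 S2 pm.
have p0 : 0 < p%:R :> R by rewrite ltr0n ltnW.
have := ler_sum (index_enum _) (P := xpredT)
  (fun a _ => sqr_shift_le a S1 S2 pm).
rewrite sum_sqr_shift // sum_cst.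
have -> : p%:R * (16%:R * m%:R ^+ 2 * S) =
  2%:R * p%:R * (8%:R * m%:R ^+ 2 * S) by ring.
by rewrite ler_pM2l // mulr_gt0.
Qed.

Lemma step_avg2_contraction k f (m : nat) : \sum_x f x = 0 ->
  (p <= 2 ^ m)%N -> (0 < m)%N ->
  \sum_x (step_avg k (step_avg k f) x) ^+ 2 <=
    (1 - (1296%:R * m%:R ^+ 2)^-1) * \sum_x f x ^+ 2.
Proof.
move=> f0 pm m0; have := sqr_sum_step_avg2 k f.
set D1 := \sum_x (f x - f (x + 1)) ^+ 2.
set D3 := \sum_x (f (x + 1) - _) ^+ 2.
have D1_0 : 0 <= D1 by apply: sumr_ge0 => x _; apply: sqr_ge0.
have D3_0 : 0 <= D3 by apply: sumr_ge0 => x _; apply: sqr_ge0.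
have S1 : D1 <= 2%:R * (D1 + D3) by lra.
have S2 : \sum_x (f x - f (2%:R * x)) ^+ 2 <= 2%:R * (D1 + D3).
  rewrite mulrDr !mulr_sumr -big_split /=; apply: ler_sum => x _.
  rewrite -subr_ge0; set X := (X in 0 <= X).
  suff -> : X = ((f x - f (x + 1)) - (f (x + 1) - f (2%:R * x))) ^+ 2.
    exact: sqr_ge0.
  by rewrite /X; ring.
(* [1296 = 81 * 8 * 2]: the loss [1 / 81], the Poincaré factor [8], and the [2] in
   [S = 2 (D1 + D3)]. *)
have := poincare f0 S1 S2 pm.
set E := \sum_x f x ^+ 2 => EP; move/le_trans; apply.
have M0 : 0 < 1296%:R * m%:R ^+ 2 :> R by rewrite mulr_gt0 // exprn_gt0 ?ltr0n.
rewrite mulrBl mul1r lerD2l lerN2 mulrC ler_pdivrMr //.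
by apply: le_trans EP _; lra.
Qed.

(** * From l2 contraction to transition probabilities *)

Lemma pollard_rho_expS k n (x y : 'Z_p) :
  (pollard_rho R k ^+ n.+1) x y =
  step_avg k (fun z => (pollard_rho R k ^+ n) z y) x.
Proof.
rewrite exprS mxE; under eq_bigr do rewrite mxE.
rewrite /step_avg -!(sum_delta (fun z => (pollard_rho R k ^+ n) z y)).
rewrite -!big_split /= mulr_suml; apply: eq_bigr => z _.
by rewrite -!mulrDl mulrAC.
Qed.

(** Column [y] of the powers, minus [1 / p], has sum zero and evolves by [step_avg]; its squared
    norm, contracted every two steps, dominates each squared entry. *)
Lemma pollard_rho_l2 k (m n : nat) (x y : 'Z_p) :
  (p <= 2 ^ m)%N -> (0 < m)%N ->
  ((pollard_rho R k ^+ (2 * n)) x y - p%:R^-1) ^+ 2 <=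
    (1 - (1296%:R * m%:R ^+ 2)^-1) ^+ n.
Proof.
move=> pm m0.
have p0 : 0 < p%:R :> R by rewrite ltr0n ltnW.
pose u i z := (pollard_rho R k ^+ i) z y - p%:R^-1.
have uS i : u i.+1 =1 step_avg k (u i).
  move=> z; rewrite /u pollard_rho_expS /step_avg; field.
  by rewrite gt_eqF.
have uSS i : u i.+2 =1 step_avg k (step_avg k (u i)).
  by move=> z; rewrite uS /step_avg !uS.
have sum_u0 : \sum_z (pollard_rho R k ^+ 0) z y = 1.
  rewrite (eq_bigr (fun z => (z == y)%:R * 1)) ?sum_delta // => z _.
  by rewrite expr0 mulr1 mxE.
have u0 i : \sum_z u i z = 0.
  elim: i => [|i IH]; last by rewrite (eq_bigr _ (fun z _ => uS i z)) sum_step_avg.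
  rewrite sumrB sum_u0 sum_cst divff ?subrr //.
  by rewrite gt_eqF.
have m1 : 1 <= m%:R :> R by rewrite ler1n.
have r0 : 0 <= 1 - (1296%:R * m%:R ^+ 2)^-1 :> R.
  rewrite subr_ge0 invf_le1; first by rewrite expr2; nra.
  by rewrite mulr_gt0 // exprn_gt0 // ltr0n.
apply: (@le_trans _ _ (\sum_z u (2 * n)%N z ^+ 2)).
  rewrite (bigD1 x) //= lerDl; apply: sumr_ge0 => z _; exact: sqr_ge0.
elim: n => [|n IH].
  rewrite muln0 expr0.
  (* Since [u 0] sums to zero, this form gives the initial squared norm [1 - 1 / p <= 1]. *)
  have E z : u 0%N z ^+ 2 = (z == y)%:R * (1 - p%:R^-1) - p%:R^-1 * u 0%N z.
    rewrite /u expr0 mxE; case: (z == y) => /=; rewrite ?mulr1n ?mulr0n; ring.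
  rewrite (eq_bigr _ (fun z _ => E z)) sumrB -mulr_sumr u0 mulr0 subr0 sum_delta.
  by rewrite gerBl invr_ge0 ltW.
rewrite mulnS add2n (eq_bigr _ (fun z _ => congr1 (fun t => t ^+ 2) (uSS _ z))).
apply: le_trans (step_avg2_contraction k (u0 _) pm m0) _.
by rewrite (exprS _ n) ler_wpM2l.
Qed.

(** By [1 - t <= exp (- t)] and [2592 = 2 * 1296], the squared deviation is at most
    [exp (- 2 N) <= (eps / p)^2]. *)
Lemma pollard_rho_sep_mixed k (eps : R) (m N : nat) :
  0 < eps -> (p <= 2 ^ m)%N -> (0 < m)%N -> ln (p%:R / eps) <= N%:R ->
  sep_mixed (pollard_rho R k) (uniform_Zp R p) eps (2 * (2592 * m ^ 2 * N)).
Proof.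
move=> e0 pm m0 lnN x y; rewrite mxE invrK.
have p0 : 0 < p%:R :> R by rewrite ltr0n ltnW.
have := pollard_rho_l2 k (2592 * m ^ 2 * N) x y pm m0.
set q := (pollard_rho R k ^+ _) x y => /le_trans ql2.
have M0 : 0 < 1296%:R * m%:R ^+ 2 :> R by rewrite mulr_gt0 // exprn_gt0 ?ltr0n.
have m1 : 1 <= m%:R :> R by rewrite ler1n.
have {ql2} : (q - p%:R^-1) ^+ 2 <= (eps / p%:R) ^+ 2.
  apply: ql2; apply: (@le_trans _ _
    (expR (- (1296%:R * m%:R ^+ 2)^-1) ^+ (2592 * m ^ 2 * N))).
    apply: lerXn2r; rewrite ?nnegrE ?expR_ge0 //; last exact: expR_ge1Dx.
    by rewrite subr_ge0 invf_le1 // expr2; nra.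
  rewrite -expRM_natl.
  have -> : (2592 * m ^ 2 * N)%:R * - (1296%:R * m%:R ^+ 2)^-1 = - (2%:R * N%:R) :> R.
    rewrite !natrM; field.
    by rewrite gt_eqF // ltr0n.
  have -> : (eps / p%:R) ^+ 2 = expR (- (2%:R * ln (p%:R / eps))).
    rewrite -mulrN expRM_natl -lnV ?posrE ?divr_gt0 // lnK ?posrE ?invr_gt0 ?divr_gt0 //.
    by rewrite invf_div.
  by rewrite ler_expR lerN2 ler_pM2l.
rewrite -(real_normK (num_real _)) ler_sqr ?nnegrE ?divr_ge0 ?(ltW e0) ?(ltW p0) //.
rewrite ler_norml => /andP[qge _].
have {qge} : (p%:R^-1 - q) * p%:R <= eps by rewrite -ler_pdivlMr //; lra.
by rewrite mulrBl mulVf // gt_eqF.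
Qed.

End OddModulus.

(** * Existence and size of the mixing time *)

(** With finitely many states, being mixed is a boolean test, so a least time can be extracted. *)
Lemma is_sep_mixing_time_exists (R : realType) (m : nat) (P : 'M[R]_m.+1)
    (pi : 'rV[R]_m.+1) (eps : R) (n : nat) :
  sep_mixed P pi eps n ->
  exists2 t, is_sep_mixing_time P pi eps t & (t <= n)%N.
Proof.
pose b i := [forall x, forall y, 1 - (P ^+ i) x y / pi 0 y <= eps].
have bP i : reflect (sep_mixed P pi eps i) (b i).
  apply: (iffP forallP) => [H x y|H x]; first exact: (forallP (H x)).
  by apply/forallP => y; apply: H.
move=> /bP bn; have ex : exists i, b i by exists n.
by case: (ex_minnP ex) => t /bP bt tmin; exists t; [split=> // i /bP /tmin|apply: tmin].
Qed.

Theorem mainTheorem4 (R : realType) :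
  exists C : R,
    forall (p : nat) (k : 'Z_p) (eps : R),
      odd p -> (3 <= p)%N -> 0 < eps -> eps < 1 ->
      exists t : nat,
        is_sep_mixing_time (pollard_rho R k) (uniform_Zp R p) eps t /\
        t%:R <= C * ln p%:R ^+ 2 * ln (p%:R / eps).
Proof.
have l2 : 0 < ln 2%:R :> R by rewrite ln_gt0 // ltr1n.
(* The last two factors come from [m <= (2 / ln 2) ln p], squared, and [N <= (1 + 1 / ln 2) L]. *)
exists (2%:R * 2592%:R * (2%:R / ln 2%:R) ^+ 2 * (1 + (ln 2%:R)^-1)).
move=> p k eps p_odd p3 e0 e1.
have p1 : (1 < p)%N by apply: leq_trans p3.
have p0 : 0 < p%:R :> R by rewrite ltr0n ltnW.
set m := up_log 2 p; set L := ln (p%:R / eps).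
have m0 : (0 < m)%N by rewrite up_log_gt0.
have pm : (p <= 2 ^ m)%N by apply: up_logP.
(* From [2^(m - 1) < p] and [m <= 2 (m - 1)], as [p >= 3] forces [m >= 2]. *)
have m_le : m%:R <= 2%:R / ln 2%:R * ln p%:R :> R.
  have m2 : (2 <= m)%N.
    by rewrite -(ltn_exp2l 1 m (isT : (1 < 2)%N)); apply: leq_trans p3 pm.
  rewrite mulrAC ler_pdivlMr //.
  apply: (@le_trans _ _ (2%:R * ((m.-1)%:R * ln 2%:R))).
    rewrite mulrA ler_pM2r // -natrM ler_nat.
    by case: (m) m2 => // i; rewrite ltnS /= mul2n -addnn -[i.+1]addn1 leq_add2l.
  rewrite ler_pM2l // mulr_natl -lnXn // ler_ln ?posrE ?exprn_gt0 //.
  by rewrite -natrX ler_nat ltnW // up_log_gtn.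
(* This lower bound lets a multiple of [L] absorb the rounding [+ 1] in [N]. *)
have L_ge : ln 2%:R <= L.
  rewrite ler_ln ?posrE ?divr_gt0 // ler_pdivlMr //.
  apply: (@le_trans _ _ (2%:R * 1)); first by rewrite ler_pM2l // ltW.
  by rewrite mulr1 ler_nat.
have L0 : 0 < L by apply: lt_le_trans L_ge.
pose N := (Num.truncn L).+1.
have N_le : N%:R <= (1 + (ln 2%:R)^-1) * L.
  have /andP[trL _] := truncn_itv (ltW L0).
  rewrite /N -natr1 mulrDl mul1r lerD // mulrC ler_pdivlMr // mul1r //.
have LN : L <= N%:R by apply/ltW/truncnS_gt.
have [t tP t_le] := is_sep_mixing_time_exists
  (pollard_rho_sep_mixed p_odd p1 k e0 pm m0 LN).
exists t; split=> //.
apply: (@le_trans _ _ (2%:R * 2592%:R * m%:R ^+ 2 * N%:R)).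
  rewrite -natrX -!natrM ler_nat; apply: leq_trans t_le _.
  by rewrite !mulnA.
set c := 2%:R / ln 2%:R in m_le *.
have -> : 2%:R * 2592%:R * c ^+ 2 * (1 + (ln 2%:R)^-1) * ln p%:R ^+ 2 * L =
  2%:R * 2592%:R * (c * ln p%:R) ^+ 2 * ((1 + (ln 2%:R)^-1) * L) by ring.
apply: ler_pM => //; first by rewrite !mulr_ge0 ?exprn_ge0.
by rewrite ler_pM2l ?mulr_gt0 // lerXn2r ?nnegrE // (le_trans _ m_le).
Qed.
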